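(* Let $d,n\ge1$, let $A_1,\dots,A_n\in\mathbb{C}^{d\times d}_{\mathrm{herm}}$, let $\Phi(S)=\sum_{i=1}^nA_iSA_i$, regarded as a linear operator on $\mathbb{C}^{d\times d}_{\mathrm{herm}}$, and let $\sigma=\big\|\sum_{i=1}^nA_i^2\big\|^{1/2}$. Suppose that there is $S\in\mathbb{C}^{d\times d}_{\mathrm{herm}}$ with $S\succ0$ such that $\Phi(S)=\lambda_{\max}(\Phi)S$. Then $$2\sqrt{\lambda_{\max}(\Phi)}\le\Lambda_{\mathrm{sc}}(0,A_1,\dots,A_n)\le\left(\sqrt{\frac{\lambda_{\min}(S)}{\lambda_{\max}(S)}}+\sqrt{\frac{\lambda_{\max}(S)}{\lambda_{\min}(S)}}\right)\sqrt{\lambda_{\max}(\Phi)}.$$ Further, when $\Phi(I_d)=\sum_{i=1}^nA_i^2=CI_d$ for some $C>0$, one may take $S=I_d$ above (that is, $\Phi(I_d)=\lambda_{\max}(\Phi)I_d$), in which case both inequalities above are equalities and $$\Lambda_{\mathrm{sc}}(0,A_1,\dots,A_n)=2\sqrt{\lambda_{\max}(\Phi)}=2\sigma.$$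
   Context: $\mathbb{C}^{d\times d}_{\mathrm{herm}}$ is the set of $d\times d$ complex Hermitian matrices with inner product $\langle X,Y\rangle=\mathrm{Tr}(X^*Y)$; $\|\cdot\|$ is the operator norm; $\succ 0$ means positive definite; $\lambda_{\min},\lambda_{\max}$ of a Hermitian matrix are its extreme eigenvalues. The operator $\Phi$ is self-adjoint for this inner product, and $\lambda_{\max}(\Phi)$ denotes its largest eigenvalue. For a bounded self-adjoint operator, $\lambda_{\max}$ is the maximum of its spectrum. A free semicircular family $(s_i)_{i=1}^n$ consists of freely independent self-adjoint operators each with the standard semicircle law on $[-2,2]$; concretely $s_i=l_i+l_i^*$ with $l_i$ the creation operators on the full Fock space over $\mathbb{C}^n$ associated to the standard basis vectors. Define $\Lambda_{\mathrm{sc}}(A_0,\dots,A_n)=\lambda_{\max}\big(A_0\otimes 1+\sum_{i=1}^n A_i\otimes s_i\big)$. Known theorem of Lehner (1999), which may be taken as an equivalent definition: $\Lambda_{\mathrm{sc}}(A_0,\dots,A_n)=\inf_{Z\in\mathbb{C}^{d\times d}_{\mathrm{herm}},Z\succ 0}\lambda_{\max}\big(Z+A_0+\sum_{i=1}^n A_iZ^{-1}A_i\big)$. *)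

(* Defs.v *)
From HB Require Import structures.
From mathcomp Require Import all_boot all_order all_algebra.
From mathcomp Require Import sesquilinear spectral.
From mathcomp Require Import classical_sets reals complex.

Set Implicit Arguments.
Unset Strict Implicit.
Unset Printing Implicit Defensive.

Import Order.TTheory GRing.Theory Num.Theory Num.Def.

Local Open Scope classical_set_scope.
Local Open Scope ring_scope.
Local Open Scope complex_scope.
Local Open Scope sesquilinear_scope.

(* X > 0. The order on R[i] is the partial one: 0 < z means that z is real and
   positive. *)
Definition posdefmx (R : realType) (d : nat) (X : 'M[R[i]]_d) : Prop :=
  X \is hermsymmx /\
  forall v : 'cV[R[i]]_d, v != 0 -> 0 < (v^t* *m X *m v) 0 0.

(* Extreme eigenvalues of a Hermitian matrix. Its eigenvalues are real and
   finitely many, and there is at least one when 0 < d, so that the supremum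
   and the infimum are then a maximum and a minimum. *)
Definition lambda_max (R : realType) (d : nat) (X : 'M[R[i]]_d) : R :=
  sup [set l : R | eigenvalue X l%:C].

Definition lambda_min (R : realType) (d : nat) (X : 'M[R[i]]_d) : R :=
  inf [set l : R | eigenvalue X l%:C].

Definition l2norm (R : realType) (d : nat) (v : 'cV[R[i]]_d) : R :=
  Num.sqrt (\sum_(j < d) Normc.normc (v j 0) ^+ 2).

Definition opnorm (R : realType) (d : nat) (X : 'M[R[i]]_d) : R :=
  sup [set l2norm (X *m v) | v in [set v : 'cV[R[i]]_d | l2norm v <= 1]].

Definition Phi (R : realType) (d n : nat) (A : 'I_n -> 'M[R[i]]_d)
    (S : 'M[R[i]]_d) : 'M[R[i]]_d :=
  \sum_(i < n) A i *m S *m A i.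

(* Largest eigenvalue of F as an operator on the real vector space of Hermitian
   matrices: only Hermitian eigenvectors are considered. *)
Definition op_lambda_max (R : realType) (d : nat)
    (F : 'M[R[i]]_d -> 'M[R[i]]_d) : R :=
  sup [set l : R | exists S : 'M[R[i]]_d,
         [/\ S \is hermsymmx, S != 0 & F S = l%:C *: S]].

(* The largest spectral value of A0 (x) 1 + \sum_i A_i (x) s_i, for (s_i) a free
   semicircular family, given by Lehner's formula. *)
Definition Lambda_sc (R : realType) (d n : nat) (A0 : 'M[R[i]]_d)
    (A : 'I_n -> 'M[R[i]]_d) : R :=
  inf [set lambda_max (Z + A0 + \sum_(i < n) A i *m invmx Z *m A i)
      | Z in [set Z : 'M[R[i]]_d | posdefmx Z]].

(* Main.v *)
Require Import Defs.
From HB Require Import structures.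
From mathcomp Require Import all_boot all_order all_algebra.
From mathcomp Require Import sesquilinear spectral.
From mathcomp Require Import classical_sets reals complex.
From mathcomp Require Import ring.

(** The eigenvector S of Phi enters Lehner's formula in two ways.

    Lower bound: as a weight. Let l be the eigenvalue of S and r = sqrt l. For
    Z > 0, self-adjointness of Phi gives
      Tr (S (Z + Phi (Z^-1))) = Tr (S (Z + l Z^-1)),
    and Z + l Z^-1 >= 2 r because z + l / z - 2 r = (z - r)^2 / z >= 0 on the
    spectrum of Z. The left-hand side is at most
    lambda_max (Z + Phi (Z^-1)) * Tr S, so dividing by Tr S > 0 bounds every
    value in the infimum from below ([lehner_value_ge]).

    Upper bound: as a trial point. With Z = c S^-1 the matrix
    Z + Phi (Z^-1) = c S^-1 + (l / c) S is a function of S alone, namely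
    s |-> c / s + l s / c on its spectrum. That function is convex, so on
    [m, M], where m and M are the extreme eigenvalues of S, it is largest at an
    end point; c = sqrt (l m M) makes the two end values equal to
    sqrt l * (sqrt (m / M) + sqrt (M / m)) ([sqrt_chord], [lehner_value_le]).
    When l = 0 this c vanishes and Z is no longer definite, so l is replaced by
    some t^2 >= l with t > 0, and t tends to sqrt l in [Lambda_sc_le].

    Scalar case: if Phi I = C I, then I is an eigenvector for C, and C is the
    top eigenvalue. Indeed, if Phi X = l X with X Hermitian and nonzero, the sum
    of the squared Frobenius norms of the commutators [X, A_i] is
    2 (C - l) Tr (X^2) ([Phi_eigen_le]). With S = I the two bounds coincide.

    The spectral calculus needed is that of the matrices U^* diag(s) U with U
    unitary and s real. *)

Set Implicit Arguments.
Unset Strict Implicit.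
Unset Printing Implicit Defensive.

Import Order.TTheory GRing.Theory Num.Theory Num.Def.

Local Open Scope ring_scope.
Local Open Scope complex_scope.

Section FreeSemicircularBounds.
Local Open Scope classical_set_scope.
Local Open Scope sesquilinear_scope.
Variables (R : realType).
Implicit Types d n : nat.

(** * Adjoints and the positive semidefinite order *)

Lemma adjmxM m n p (X : 'M[R[i]]_(m, n)) (Y : 'M[R[i]]_(n, p)) :
  (X *m Y)^t* = Y^t* *m X^t*.
Proof. by rewrite trmx_mul map_mxM. Qed.

Lemma hermsymmx_adj d (X : 'M[R[i]]_d) : X \is hermsymmx <-> X^t* = X.
Proof.
split; first by move/is_hermitianmxP; rewrite expr0 scale1r => {2}->.
by move=> XX; apply/is_hermitianmxP; rewrite expr0 scale1r XX.
Qed.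

Lemma conjC_real (r : R) : conjC (r%:C) = r%:C :> R[i].
Proof. by apply/CrealP; apply/complex_realP; exists r. Qed.

Definition psdmx d (M : 'M[R[i]]_d) : Prop :=
  forall v : 'cV[R[i]]_d, 0 <= (v^t* *m M *m v) 0 0.

Lemma psdmx_sandwich d (M B : 'M[R[i]]_d) : psdmx M -> psdmx (B^t* *m M *m B).
Proof. by move=> M0 v; have := M0 (B *m v); rewrite adjmxM !mulmxA. Qed.

Lemma psdmx_sum d n (F : 'I_n -> 'M[R[i]]_d) :
  (forall i, psdmx (F i)) -> psdmx (\sum_i F i).
Proof.
move=> F0 v; rewrite mulmx_sumr mulmx_suml summxE sumr_ge0 // => i _.
exact: F0.
Qed.

(** * Functional calculus in a fixed eigenbasis *)

(** For a fixed unitary U these matrices form a commutative algebra, on which all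
    operations act entrywise on s. *)
Definition udiag d (U : 'M[R[i]]_d) (s : 'rV[R]_d) : 'M[R[i]]_d :=
  U^t* *m diag_mx (map_mx (real_complex R) s) *m U.

Lemma hermitian_spectral d (X : 'M[R[i]]_d) : X \is hermsymmx ->
  exists2 U, U \is unitarymx & exists s, X = udiag U s.
Proof.
move=> Xh; exists (spectralmx X); first exact: spectral_unitarymx.
exists (map_mx (@complex.Re R) (spectral_diag X)).
have /orthomx_spectralP {1}-> := hermitian_normalmx Xh.
rewrite invmx_unitary; last exact: spectral_unitarymx.
rewrite /udiag -map_mx_comp.
apply: (congr1 (fun D => _ *m diag_mx D *m _)); apply/rowP => k.
rewrite !mxE /=.
have /mxOverP/(_ 0 k)/complex_realP[r ->] := hermitian_spectral_diag_real Xh.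
by [].
Qed.

Section Udiag.
Variables (d : nat) (U : 'M[R[i]]_d).
Implicit Types (s t : 'rV[R]_d) (M : 'M[R[i]]_d).
Hypothesis Uu : U \is unitarymx.

Let UUt : U *m U^t* = 1%:M. Proof. exact/unitarymxP. Qed.
Let UtU : U^t* *m U = 1%:M. Proof. exact/mulmx1C. Qed.

Lemma udiag_const (r : R) : udiag U (const_mx r) = r%:C%:M.
Proof.
rewrite /udiag map_const_mx diag_const_mx mul_mx_scalar -scalemxAl UtU.
by rewrite scalemx1.
Qed.

Lemma udiagD s t : udiag U (s + t) = udiag U s + udiag U t.
Proof. by rewrite /udiag map_mxD linearD /= mulmxDr mulmxDl. Qed.

Lemma udiagZ (r : R) s : udiag U (r *: s) = r%:C *: udiag U s.
Proof. by rewrite /udiag map_mxZ linearZ /= -scalemxAr -scalemxAl. Qed.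

Lemma udiagB s t : udiag U (s - t) = udiag U s - udiag U t.
Proof. by rewrite udiagD -scaleN1r udiagZ rmorphN1 scaleN1r. Qed.

Lemma udiagM s t : udiag U s *m udiag U t = udiag U (\row_k (s 0 k * t 0 k)).
Proof.
rewrite /udiag -!mulmxA (mulmxA U) UUt mul1mx; congr (_ *m _).
rewrite mulmxA mulmx_diag; congr (diag_mx _ *m _).
by apply/rowP => k; rewrite !mxE rmorphM.
Qed.

Lemma invmx_udiag s : (forall k, s 0 k != 0) ->
  invmx (udiag U s) = udiag U (\row_k (s 0 k)^-1).
Proof.
move=> s0; have e : udiag U s *m udiag U (\row_k (s 0 k)^-1) = 1%:M.
  rewrite udiagM -[1%:M]/((1:R)%:C%:M) -udiag_const; congr udiag.
  by apply/rowP => k; rewrite !mxE divff.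
have [Su _] := mulmx1_unit e.
by rewrite -[RHS](mulKmx Su) e mulmx1.
Qed.

Lemma adjmx_udiag s : (udiag U s)^t* = udiag U s.
Proof.
rewrite /udiag !adjmxM trmxCK mulmxA tr_diag_mx map_diag_mx.
apply: (congr1 (fun D => _ *m diag_mx D *m _)); apply/rowP => k.
by rewrite !mxE; exact: conjC_real.
Qed.

(** [eigenvalue] concerns left eigenvectors: the k-th one is the k-th row of
    U. *)
Lemma eigenvalue_udiag s (l : R) :
  eigenvalue (udiag U s) l%:C <-> exists k, l = s 0 k.
Proof.
split=> [/eigenvalueP[v vX v0]|[k ->]].
  have w0 : v *m U^t* != 0.
    by apply: contra v0 => /eqP w0; rewrite -[v]mulmx1 -UtU mulmxA w0 mul0mx.
  have [k wk] : exists k, (v *m U^t*) 0 k != 0 by apply/rV0Pn.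
  exists k; move/(congr1 (fun w => (w *m U^t*) 0 k)): vX.
  rewrite /udiag !mulmxA -(mulmxA _ U) UUt mulmx1 mul_mx_diag -scalemxAl.
  move: (v *m U^t*) wk => w wk; rewrite !mxE mulrC => h.
  by have [] := mulIf wk h.
apply/eigenvalueP; exists (delta_mx 0 k *m U).
  rewrite /udiag !mulmxA -(mulmxA _ U) UUt mulmx1 scalemxAl; congr (_ *m _).
  apply/rowP => j; rewrite mul_mx_diag !mxE eqxx /= mulrC.
  by case: eqP => [->|]; rewrite ?mulr0.
apply/eqP => /(congr1 (fun w => (w *m U^t*) 0 k)).
by rewrite -mulmxA UUt mulmx1 mul0mx !mxE !eqxx => /eqP; rewrite oner_eq0.
Qed.

Lemma udiag_form s (v : 'cV[R[i]]_d) :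
  (v^t* *m udiag U s *m v) 0 0 = \sum_k (s 0 k)%:C * `|(U *m v) k 0| ^+ 2.
Proof.
rewrite /udiag !mulmxA -adjmxM -mulmxA mul_mx_diag mxE; apply: eq_bigr => k _.
by rewrite mxE; move: (U *m v) => w; rewrite !mxE normCK mulrC mulrA mulrC.
Qed.

Lemma psdmx_udiag s : (forall k, 0 <= s 0 k) -> psdmx (udiag U s).
Proof.
move=> s0 v; rewrite udiag_form sumr_ge0 // => k _.
by rewrite mulr_ge0 ?ler0c ?exprn_ge0.
Qed.

Lemma mxtrace_udiag s : \tr (udiag U s) = (\sum_k s 0 k)%:C.
Proof.
rewrite /udiag mxtrace_mulC mulmxA UUt mul1mx mxtrace_diag rmorph_sum /=.
by apply: eq_bigr => k _; rewrite mxE.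
Qed.

(** In the eigenbasis the trace is the combination, with the nonnegative weights
    s, of the diagonal entries of U M U^*, which are values of the quadratic form
    of M. *)
Lemma mxtraceM_udiag_psd_ge0 s M : (forall k, 0 <= s 0 k) -> psdmx M ->
  0 <= \tr (udiag U s *m M).
Proof.
move=> s0 M0; rewrite /udiag -!mulmxA mxtrace_mulC -!mulmxA mul_diag_mx.
rewrite sumr_ge0 // => k _; rewrite !mxE mulr_ge0 ?ler0c //.
(* test M on the k-th eigenvector *)
have := M0 (U^t* *m delta_mx k 0); rewrite adjmxM trmxCK !mulmxA.
rewrite -!mulmxA.
have -> : (delta_mx k 0 : 'cV[R[i]]_d)^t* = delta_mx 0 k.
  by rewrite trmx_delta map_delta_mx.
by rewrite -rowE mxE !mulmxA -colE mxE -mulmxA mxE.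
Qed.

(** The k-th entry of s is the value of the quadratic form at the k-th
    eigenvector. *)
Lemma udiag_posdef_gt0 s : posdefmx (udiag U s) -> forall k, 0 < s 0 k.
Proof.
move=> [_ S0] k.
have e0 : U^t* *m delta_mx k 0 != 0 :> 'cV_d.
  apply/eqP => /(congr1 (fun w => (U *m w) k 0)).
  by rewrite mulmxA UUt mul1mx mulmx0 !mxE !eqxx => /eqP; rewrite oner_eq0.
have := S0 _ e0; rewrite /udiag adjmxM trmxCK !mulmxA.
rewrite -(mulmxA _ U) UUt mulmx1 -(mulmxA _ U) UUt mulmx1.
rewrite trmx_delta map_delta_mx -rowE -colE !mxE eqxx.
by rewrite mulr1n -(ltcR 0).
Qed.

Hypothesis hd : (0 < d)%N.

(** The supremum defining [lambda_max] is genuine because the spectrum consists of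
    the finitely many entries of s, hence is bounded by the sum of their absolute
    values. *)
Lemma udiag_le_lambda_max s k : s 0 k <= lambda_max (udiag U s).
Proof.
apply: ub_le_sup; last by apply/eigenvalue_udiag; exists k.
exists (\sum_j `|s 0 j|) => l /eigenvalue_udiag[j ->].
by rewrite (bigD1 j) //= (le_trans (ler_norm _)) // lerDl sumr_ge0.
Qed.

Lemma lambda_min_le_udiag s k : lambda_min (udiag U s) <= s 0 k.
Proof.
apply: ge_inf; last by apply/eigenvalue_udiag; exists k.
exists (- \sum_j `|s 0 j|) => l /eigenvalue_udiag[j ->].
rewrite lerNl (bigD1 j) //= -[leLHS]addr0 lerD ?sumr_ge0 //.
by rewrite -normrN ler_norm.
Qed.

Lemma lambda_max_udiag_le s b : (forall k, s 0 k <= b) ->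
  lambda_max (udiag U s) <= b.
Proof.
move=> sb; apply: ge_sup => [|l /eigenvalue_udiag[k ->]//].
by exists (s 0 (Ordinal hd)); apply/eigenvalue_udiag; exists (Ordinal hd).
Qed.

Lemma lambda_min_udiag_gt0 s : (forall k, 0 < s 0 k) ->
  0 < lambda_min (udiag U s).
Proof.
move=> s0; have [k _ kmin] := arg_minP (s 0) (isT : xpredT (Ordinal hd)).
apply: (lt_le_trans (s0 k)); apply: lb_le_inf => [|l /eigenvalue_udiag[j ->]].
  by exists (s 0 k); apply/eigenvalue_udiag; exists k.
exact: kmin.
Qed.

End Udiag.

(** * Extreme eigenvalues, traces and positivity *)

Lemma posdefmx_spectral d (X : 'M[R[i]]_d) : posdefmx X ->
  exists2 U, U \is unitarymx &
    exists2 s, X = udiag U s & forall k, 0 < s 0 k.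
Proof.
move=> Xp; have [U Uu [s Xs]] := hermitian_spectral (proj1 Xp).
by exists U => //; exists s => //; apply: (udiag_posdef_gt0 Uu); rewrite -Xs.
Qed.

Lemma unitarymx1 d : (1%:M : 'M[R[i]]_d) \is unitarymx.
Proof. by apply/unitarymxP; rewrite trmx1 map_mx1 mulmx1. Qed.

Lemma posdefmx_udiag d (U : 'M[R[i]]_d) (s : 'rV_d) : U \is unitarymx ->
  (forall k, 0 < s 0 k) -> posdefmx (udiag U s).
Proof.
move=> Uu s0; split; first exact/hermsymmx_adj/adjmx_udiag.
move=> v v0; have UtU : U^t* *m U = 1%:M by exact/mulmx1C/unitarymxP.
have [k wk] : exists k, (U *m v) k 0 != 0.
  apply/cV0Pn; apply: contra v0 => /eqP w0.
  by rewrite -[v]mul1mx -UtU -mulmxA w0 mulmx0.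
rewrite udiag_form (bigD1 k) //= ltr_wpDr ?sumr_ge0 // => [j _|].
  by rewrite mulr_ge0 ?ler0c ?exprn_ge0 // ltW.
by rewrite mulr_gt0 ?exprn_gt0 ?normr_gt0 // (ltcR 0).
Qed.

Lemma lambda_max_psdmx d (X : 'M[R[i]]_d) : X \is hermsymmx ->
  psdmx ((lambda_max X)%:C%:M - X).
Proof.
move=> /hermitian_spectral[U Uu [s ->]].
rewrite -(udiag_const Uu) -udiagB; apply: psdmx_udiag => // k.
by rewrite !mxE subr_ge0 udiag_le_lambda_max.
Qed.

Lemma mxtraceM_posdef_psd_ge0 d (S M : 'M[R[i]]_d) : posdefmx S -> psdmx M ->
  0 <= \tr (S *m M).
Proof.
move=> /posdefmx_spectral[U Uu [s -> s0]] M0.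
by apply: mxtraceM_udiag_psd_ge0 => // k; exact: ltW.
Qed.

Lemma mxtrace_posdef_gt0 d (S : 'M[R[i]]_d) : (0 < d)%N -> posdefmx S ->
  exists2 t : R, 0 < t & \tr S = t%:C.
Proof.
move=> hd /posdefmx_spectral[U Uu [s -> s0]]; exists (\sum_k s 0 k).
  rewrite (bigD1 (Ordinal hd)) //= ltr_wpDr // sumr_ge0 // => k _.
  exact: ltW.
exact: mxtrace_udiag.
Qed.

(** * The operator Phi *)

(** Phi is self-adjoint because each A_i stands on both sides: the cyclicity of
    the trace moves the outer A_i from T to S. *)
Lemma mxtrace_Phi_adjoint d n (A : 'I_n -> 'M[R[i]]_d) (S T : 'M[R[i]]_d) :
  \tr (S *m Phi A T) = \tr (Phi A S *m T).
Proof.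
rewrite /Phi mulmx_sumr mulmx_suml !raddf_sum; apply: eq_bigr => i _ /=.
by rewrite -!mulmxA [RHS]mxtrace_mulC !mulmxA.
Qed.

Lemma hermsymmx_Phi d n (A : 'I_n -> 'M[R[i]]_d) (S : 'M[R[i]]_d) :
  (forall i, A i \is hermsymmx) -> S \is hermsymmx -> Phi A S \is hermsymmx.
Proof.
move=> hA /hermsymmx_adj hS; apply/hermsymmx_adj; rewrite /Phi raddf_sum /= raddf_sum.
apply: eq_bigr => i _ /=; have /hermsymmx_adj hAi := hA i.
by rewrite !adjmxM hS hAi mulmxA.
Qed.

Lemma psdmx_Phi d n (A : 'I_n -> 'M[R[i]]_d) (S : 'M[R[i]]_d) :
  (forall i, A i \is hermsymmx) -> psdmx S -> psdmx (Phi A S).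
Proof.
move=> hA S0; apply: psdmx_sum => i.
by have /hermsymmx_adj {1}<- := hA i; exact: psdmx_sandwich.
Qed.

Lemma posdefmx_psd d (S : 'M[R[i]]_d) : posdefmx S -> psdmx S.
Proof.
move=> [_ S0] v; have [->|v0] := eqVneq v 0; first by rewrite mulmx0 mxE.
exact/ltW/S0.
Qed.

(** Phi preserves positivity, so that Phi S = l S is positive semidefinite; a
    single vector then decides the sign of l. *)
Lemma Phi_eigen_ge0 d n (A : 'I_n -> 'M[R[i]]_d) (S : 'M[R[i]]_d) (l : R) :
  (0 < d)%N -> (forall i, A i \is hermsymmx) ->
  posdefmx S -> Phi A S = l%:C *: S -> 0 <= l.
Proof.
move=> hd hA S0 e; have /(_ (delta_mx (Ordinal hd) 0)) := psdmx_Phi hA (posdefmx_psd S0).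
have v0 : delta_mx (Ordinal hd) 0 != 0 :> 'cV[R[i]]_d.
  by apply/cV0Pn; exists (Ordinal hd); rewrite mxE !eqxx oner_eq0.
rewrite e -scalemxAr -scalemxAl mxE pmulr_lge0 ?(proj2 S0) //.
by rewrite ler0c.
Qed.

(** * Lower bound: the eigenvector as a weight *)

(** Pairing with S replaces Phi by multiplication by l, after which
    Z + l Z^-1 >= 2 sqrt l is a scalar inequality in the eigenbasis of Z. *)
Lemma lehner_value_ge d n (A : 'I_n -> 'M[R[i]]_d) (S Z : 'M[R[i]]_d) (l : R) :
  (0 < d)%N -> (forall i, A i \is hermsymmx) ->
  posdefmx S -> Phi A S = l%:C *: S -> posdefmx Z ->
  2 * Num.sqrt l <= lambda_max (Z + Phi A (invmx Z)).
Proof.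
move=> hd hA S0 e Z0; have l0 := Phi_eigen_ge0 hd hA S0 e.
have [t t0 St] := mxtrace_posdef_gt0 hd S0.
have [U Uu [z Zz z0]] := posdefmx_spectral Z0.
have Zi : invmx Z = udiag U (\row_k (z 0 k)^-1).
  by rewrite Zz invmx_udiag // => k; rewrite gt_eqF.
have Xh : Z + Phi A (invmx Z) \is hermsymmx.
  apply/hermsymmx_adj; rewrite raddfD /= raddfD /=; congr (_ + _).
    exact/hermsymmx_adj/(proj1 Z0).
  apply/hermsymmx_adj/hermsymmx_Phi => //; apply/hermsymmx_adj.
  by rewrite Zi adjmx_udiag.
set r := Num.sqrt l.
have amgm : psdmx (Z + l%:C *: invmx Z - (2 * r)%:C%:M).
  rewrite Zi Zz -udiagZ -udiagD -(udiag_const Uu) -udiagB.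
  apply: psdmx_udiag => // k; rewrite !mxE.
  have -> : z 0 k + l * (z 0 k)^-1 - 2 * r = (z 0 k - r) ^+ 2 / z 0 k.
    rewrite -[l in l * _](sqr_sqrtr l0) -/r.
    by field; rewrite gt_eqF.
  by rewrite divr_ge0 ?sqr_ge0 // ltW.
have h1 := mxtraceM_posdef_psd_ge0 S0 (lambda_max_psdmx Xh).
have h2 := mxtraceM_posdef_psd_ge0 S0 amgm.
have := addr_ge0 h1 h2.
rewrite !mulmxBr !mulmxDr !raddfB /= !raddfD /= mxtrace_Phi_adjoint e.
rewrite -scalemxAl -scalemxAr.
rewrite !mul_mx_scalar !mxtraceZ St.
rewrite -opprD addrA subrK -mulrBl -rmorphB /= -rmorphM /= ler0c.
by rewrite pmulr_lge0 // subr_ge0.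
Qed.

(** * Upper bound: the inverse of the eigenvector as a trial point *)

(** The function g(s) = sqrt (m M) / s + s / sqrt (m M) is convex and takes the
    value on the right at both end points m and M. Explicitly, the difference of
    the two sides is (s - m) (M - s) / (s sqrt (m M)). *)
Lemma sqrt_chord (m M s : R) : 0 < m -> m <= s <= M ->
  Num.sqrt m * Num.sqrt M / s + s / (Num.sqrt m * Num.sqrt M) <=
  Num.sqrt (m / M) + Num.sqrt (M / m).
Proof.
move=> m0 /andP[ms sM]; have s0 := lt_le_trans m0 ms.
have M0 := lt_le_trans s0 sM.
rewrite !sqrtrM ?(ltW m0) ?(ltW M0) // !sqrtrV ?(ltW m0) ?(ltW M0) //.
have := ms; have := sM.
rewrite -{1}(sqr_sqrtr (ltW m0)) -{1}(sqr_sqrtr (ltW M0)).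
have : 0 < Num.sqrt m by rewrite sqrtr_gt0.
have : 0 < Num.sqrt M by rewrite sqrtr_gt0.
move: (Num.sqrt m) (Num.sqrt M) => p q q0 p0 sq ps; rewrite -subr_ge0.
have -> : p / q + q / p - (p * q / s + s / (p * q)) =
          (s - p ^+ 2) * (q ^+ 2 - s) / (p * q * s).
  by field; rewrite !gt_eqF.
by rewrite divr_ge0 ?mulr_ge0 ?subr_ge0 // ltW.
Qed.

(** The trial point is Z = c S^-1 with c = t sqrt (m M), for m and M the extreme
    eigenvalues of S; the parameter t > 0 stands in for sqrt l, which may
    vanish. *)
Lemma lehner_value_le d n (A : 'I_n -> 'M[R[i]]_d) (S : 'M[R[i]]_d) (l t : R) :
  (0 < d)%N -> posdefmx S -> Phi A S = l%:C *: S -> 0 < t -> l <= t ^+ 2 ->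
  exists2 Z, posdefmx Z & lambda_max (Z + Phi A (invmx Z)) <=
    (Num.sqrt (lambda_min S / lambda_max S) +
     Num.sqrt (lambda_max S / lambda_min S)) * t.
Proof.
move=> hd /posdefmx_spectral[U Uu [s -> s0]] e t0 lt2.
set m := lambda_min _; set M := lambda_max _.
have m0 : 0 < m by exact: lambda_min_udiag_gt0.
have ms k : m <= s 0 k <= M.
  by rewrite lambda_min_le_udiag // udiag_le_lambda_max.
have M0 : 0 < M.
  by have /andP[a b] := ms (Ordinal hd); exact: lt_le_trans (le_trans a b).
pose c := t * (Num.sqrt m * Num.sqrt M).
have c0 : 0 < c by rewrite !mulr_gt0 ?sqrtr_gt0.
exists (udiag U (\row_k (c / s 0 k))).
  by apply: posdefmx_udiag => // k; rewrite mxE divr_gt0.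
rewrite invmx_udiag // => [|k]; last by rewrite mxE gt_eqF ?divr_gt0.
have -> : udiag U (\row_k ((\row_j (c / s 0 j)) 0 k)^-1) = (c^-1)%:C *: udiag U s.
  by rewrite -udiagZ; congr udiag; apply/rowP => k; rewrite !mxE invf_div mulrC.
have -> : Phi A ((c^-1)%:C *: udiag U s) = udiag U ((c^-1 * l) *: s).
  rewrite udiagZ rmorphM /= -scalerA -e /Phi scaler_sumr; apply: eq_bigr => i _.
  by rewrite -scalemxAr -scalemxAl.
(* everything is now diagonal in the eigenbasis of S *)
rewrite -udiagD; apply: lambda_max_udiag_le => // k; rewrite !mxE.
have sk := s0 k.
apply: (@le_trans _ _ ((Num.sqrt m * Num.sqrt M / s 0 k +
                        s 0 k / (Num.sqrt m * Num.sqrt M)) * t)); last first.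
  by rewrite ler_pM2r // sqrt_chord.
rewrite mulrDl lerD //; first by rewrite /c -mulrA mulrC -mulrA mulrAC.
rewrite -[leLHS]mulrA [leLHS]mulrC ler_pdivrMr //.
have -> : s 0 k / (Num.sqrt m * Num.sqrt M) * t * c = t ^+ 2 * s 0 k.
  by rewrite /c; field; rewrite !gt_eqF // sqrtr_gt0.
by rewrite ler_pM2r.
Qed.

(** * Bounds on the infimum *)

Lemma Lambda_sc0E d n (A : 'I_n -> 'M[R[i]]_d) :
  Lambda_sc 0 A =
  inf [set lambda_max (Z + Phi A (invmx Z)) | Z in [set Z | posdefmx Z]].
Proof.
rewrite /Lambda_sc; apply: (congr1 inf); apply/seteqP.
by split=> _ [Z Z0 <-]; exists Z; [exact: Z0|rewrite addr0|exact: Z0|rewrite addr0].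
Qed.

Lemma posdefmx1 d : posdefmx (1%:M : 'M[R[i]]_d).
Proof.
have U1 := unitarymx1 d.
rewrite -[1%:M]/((1:R)%:C%:M) -(udiag_const U1).
by apply: posdefmx_udiag => // k; rewrite mxE.
Qed.

Lemma Lambda_sc_ge d n (A : 'I_n -> 'M[R[i]]_d) (S : 'M[R[i]]_d) (l : R) :
  (0 < d)%N -> (forall i, A i \is hermsymmx) ->
  posdefmx S -> Phi A S = l%:C *: S -> 2 * Num.sqrt l <= Lambda_sc 0 A.
Proof.
move=> hd hA S0 e; rewrite Lambda_sc0E; apply: lb_le_inf.
  by exists (lambda_max (1%:M + Phi A (invmx 1%:M))), 1%:M; [exact: posdefmx1|].
by move=> _ [Z Z0 <-]; exact: lehner_value_ge hd hA S0 e Z0.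
Qed.

Lemma Lambda_sc_le d n (A : 'I_n -> 'M[R[i]]_d) (S : 'M[R[i]]_d) (l : R) :
  (0 < d)%N -> (forall i, A i \is hermsymmx) ->
  posdefmx S -> Phi A S = l%:C *: S ->
  Lambda_sc 0 A <= (Num.sqrt (lambda_min S / lambda_max S) +
     Num.sqrt (lambda_max S / lambda_min S)) * Num.sqrt l.
Proof.
move=> hd hA S0 e; have l0 := Phi_eigen_ge0 hd hA S0 e.
set K := _ + _; have K0 : 0 <= K by rewrite addr_ge0 ?sqrtr_ge0.
(* the choice t = sqrt l + eps / (K + 1) makes K * t at most K * sqrt l + eps *)
apply/ler_addgt0Pr => eps eps0; pose t := Num.sqrt l + eps / (K + 1).
have K1 : 0 < K + 1 by rewrite ltr_wpDl.
have d0 : 0 < eps / (K + 1) by rewrite divr_gt0.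
have t0 : 0 < t by rewrite ltr_wpDl ?sqrtr_ge0.
have lt2 : l <= t ^+ 2.
  by rewrite -{1}(sqr_sqrtr l0) lerXn2r ?nnegrE ?sqrtr_ge0 ?(ltW t0) // lerDl ltW.
have [Z Z0 leZ] := lehner_value_le hd S0 e t0 lt2.
apply: (@le_trans _ _ (K * t)).
  rewrite Lambda_sc0E; apply: le_trans leZ; apply: ge_inf; last by exists Z.
  (* the infimum is genuine because the lower bound holds for every value *)
  exists (2 * Num.sqrt l) => _ [Y Y0 <-].
  exact: lehner_value_ge hd hA S0 e Y0.
rewrite mulrDr lerD2l mulrCA ler_piMr ?(ltW eps0) //.
by rewrite ler_pdivrMr // mul1r lerDl.
Qed.

(** * The scalar case *)

Lemma mxtrace_adjmxM m n (X : 'M[R[i]]_(m, n)) :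
  \tr (X^t* *m X) = \sum_j \sum_i `|X i j| ^+ 2.
Proof.
apply: eq_bigr => j _; rewrite mxE; apply: eq_bigr => i _.
by rewrite !mxE normCK mulrC.
Qed.

(** For Hermitian X and Y the left-hand side is the squared Frobenius norm of the
    commutator of X and Y. *)
Lemma mxtrace_commutator (K : comNzRingType) d (X Y : 'M[K]_d) :
  \tr ((Y *m X - X *m Y) *m (X *m Y - Y *m X)) =
  2 * (\tr (X *m (Y *m Y) *m X) - \tr (X *m (Y *m X *m Y))).
Proof.
rewrite mulmxBl !mulmxBr !raddfB /= -!mulmxA.
rewrite (mxtrace_mulC Y (X *m (X *m Y))) (mxtrace_mulC Y (X *m (Y *m X))).
rewrite -!mulmxA [\tr (X *m (X *m (Y *m Y)))]mxtrace_mulC -!mulmxA.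
by ring.
Qed.

(** Summed over i, the squared Frobenius norms of the commutators of S and A_i
    give 2 (C - l) Tr (S^2), where C comes from the terms S A_i^2 S and l from
    the terms S A_i S A_i. *)
Lemma Phi_eigen_le d n (A : 'I_n -> 'M[R[i]]_d) (S : 'M[R[i]]_d) (C l : R) :
  (forall i, A i \is hermsymmx) -> Phi A 1%:M = C%:C *: 1%:M ->
  S \is hermsymmx -> S != 0 -> Phi A S = l%:C *: S -> l <= C.
Proof.
move=> hA hC /hermsymmx_adj hS S0 e.
have t0 : 0 < \tr (S *m S).
  rewrite -{1}hS mxtrace_adjmxM.
  have [i [j Sij]] : exists i j, S i j != 0 by exact/matrix0Pn.
  have ge0 (j' : 'I_d) : 0 <= \sum_(i' < d) `|S i' j'| ^+ 2.
    by apply: sumr_ge0 => k _; rewrite exprn_ge0.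
  rewrite (bigD1 j) //= ltr_wpDr ?sumr_ge0 //.
  rewrite (bigD1 i) //= ltr_wpDr ?exprn_gt0 ?normr_gt0 //.
  by rewrite sumr_ge0 // => k _; rewrite exprn_ge0.
have : 0 <= \sum_i \tr ((S *m A i - A i *m S)^t* *m (S *m A i - A i *m S)).
  apply: sumr_ge0 => i _; rewrite mxtrace_adjmxM.
  by apply: sumr_ge0 => j _; apply: sumr_ge0 => k _; rewrite exprn_ge0.
have term i : \tr ((S *m A i - A i *m S)^t* *m (S *m A i - A i *m S)) =
    2 * (\tr (S *m (A i *m 1%:M *m A i) *m S) - \tr (S *m (A i *m S *m A i))).
  have /hermsymmx_adj hAi := hA i.
  rewrite mulmx1 -mxtrace_commutator; congr (\tr (_ *m _)).
  by rewrite raddfB /= raddfB /= !adjmxM hS hAi.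
rewrite (eq_bigr _ (fun i _ => term i)) -mulr_sumr pmulr_rge0 // sumrB.
have -> : \sum_i \tr (S *m (A i *m 1%:M *m A i) *m S) = C%:C * \tr (S *m S).
  rewrite -raddf_sum /= -mulmx_suml -mulmx_sumr -[X in S *m X]/(Phi A 1%:M) hC.
  by rewrite -scalemxAr mulmx1 -scalemxAl mxtraceZ.
have -> : \sum_i \tr (S *m (A i *m S *m A i)) = l%:C * \tr (S *m S).
  rewrite -raddf_sum /= -mulmx_sumr -[X in S *m X]/(Phi A S) e.
  by rewrite -scalemxAr mxtraceZ.
by rewrite -mulrBl pmulr_lge0 // -rmorphB /= ler0c subr_ge0.
Qed.

Lemma op_lambda_max_scalar d n (A : 'I_n -> 'M[R[i]]_d) (C : R) : (0 < d)%N ->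
  (forall i, A i \is hermsymmx) -> Phi A 1%:M = C%:C *: 1%:M ->
  op_lambda_max (Phi A) = C.
Proof.
move=> hd hA hC; have ub l : (exists S : 'M[R[i]]_d,
    [/\ S \is hermsymmx, S != 0 & Phi A S = l%:C *: S]) -> l <= C.
  by move=> [S [Sh S0 e]]; exact: Phi_eigen_le hA hC Sh S0 e.
have inC : exists S : 'M[R[i]]_d,
    [/\ S \is hermsymmx, S != 0 & Phi A S = C%:C *: S].
  exists 1%:M; split => //; first exact: (proj1 (posdefmx1 d)).
  by apply/matrix0Pn; exists (Ordinal hd), (Ordinal hd); rewrite mxE eqxx oner_eq0.
apply/eqP; rewrite eq_le; apply/andP; split.
  by apply: ge_sup; [exists C|exact: ub].
by apply: ub_le_sup; [exists C; exact: ub|].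
Qed.

Lemma opnorm_scalar d (C : R) : (0 < d)%N -> 0 <= C ->
  opnorm (C%:C *: 1%:M : 'M[R[i]]_d) = C.
Proof.
move=> hd C0; have normC (v : 'cV[R[i]]_d) :
    l2norm ((C%:C *: 1%:M) *m v) = C * l2norm v.
  rewrite /l2norm -scalemxAl mul1mx.
  rewrite -[in RHS](ger0_norm C0) -sqrtr_sqr -sqrtrM ?sqr_ge0 // mulr_sumr.
  congr Num.sqrt; apply: eq_bigr => j _; rewrite mxE Normc.normcM exprMn.
  by rewrite /= expr0n addr0 sqr_sqrtr ?sqr_ge0.
have e1 : l2norm (delta_mx (Ordinal hd) 0 : 'cV[R[i]]_d) = 1.
  rewrite /l2norm (bigD1 (Ordinal hd)) //= big1 => [|j /negbTE jn].
    by rewrite mxE !eqxx Normc.normc1 expr1n addr0 sqrtr1.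
  by rewrite mxE jn Normc.normc0 expr0n.
apply/eqP; rewrite eq_le; apply/andP; split.
  apply: ge_sup => [|_ [v v1 <-]]; last by rewrite normC ler_piMr.
  by exists (l2norm ((C%:C *: 1%:M) *m (0 : 'cV[R[i]]_d))), 0 => //=;
    rewrite /l2norm big1 ?sqrtr0 // => j _; rewrite mxE Normc.normc0 expr0n.
apply: ub_le_sup; first by exists C => _ [v v1 <-]; rewrite normC ler_piMr.
by exists (delta_mx (Ordinal hd) 0); rewrite /= ?normC e1 ?mulr1.
Qed.

Lemma eigenvalues_mx1 d : (0 < d)%N ->
  [set l : R | eigenvalue (1%:M : 'M[R[i]]_d) l%:C] = [set 1].
Proof.
move=> hd; have U1 := unitarymx1 d.
rewrite -[1%:M]/((1:R)%:C%:M) -(udiag_const U1); apply/seteqP.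
split=> l /= => [/(eigenvalue_udiag U1)[k]|->]; first by rewrite mxE.
by apply/(eigenvalue_udiag U1); exists (Ordinal hd); rewrite mxE.
Qed.

End FreeSemicircularBounds.

Theorem corollary4p13 (R : realType) (d n : nat) (hd : (0 < d)%N)
    (hn : (0 < n)%N) (A : 'I_n -> 'M[R[i]]_d)
    (hA : forall i : 'I_n, A i \is hermsymmx) :
  let lam : R := op_lambda_max (Phi A) in
  let sigma : R := Num.sqrt (opnorm (\sum_(i < n) A i *m A i)) in
  let upper (S : 'M[R[i]]_d) : R :=
    (Num.sqrt (lambda_min S / lambda_max S) +
     Num.sqrt (lambda_max S / lambda_min S)) * Num.sqrt lam in
  (forall S : 'M[R[i]]_d, posdefmx S -> Phi A S = lam%:C *: S ->
     2 * Num.sqrt lam <= Lambda_sc 0 A /\ Lambda_sc 0 A <= upper S)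
  /\
  Phi A 1%:M = \sum_(i < n) A i *m A i
  /\
  (forall C : R, 0 < C -> Phi A 1%:M = C%:C *: 1%:M ->
     [/\ posdefmx (1%:M : 'M[R[i]]_d),
         Phi A 1%:M = lam%:C *: 1%:M,
         2 * Num.sqrt lam = Lambda_sc 0 A,
         Lambda_sc 0 A = upper 1%:M &
         Lambda_sc 0 A = 2 * Num.sqrt lam /\ 2 * Num.sqrt lam = 2 * sigma]).
Proof.
move=> lam sigma upper; split=> [S S0 e|].
  by split; [exact: Lambda_sc_ge S0 e|exact: Lambda_sc_le S0 e].
have PhiI : Phi A 1%:M = \sum_(i < n) A i *m A i.
  by apply: eq_bigr => i _; rewrite mulmx1.
split=> // C C0 hC.
have lamC : lam = C by exact: op_lambda_max_scalar.
have I0 := posdefmx1 R d.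
have eI : Phi A 1%:M = lam%:C *: 1%:M by rewrite lamC.
have upI : upper 1%:M = 2 * Num.sqrt lam.
  rewrite /upper /lambda_min /lambda_max eigenvalues_mx1 // sup1 inf1 divr1.
  by rewrite sqrtr1.
have LE : Lambda_sc 0 A = 2 * Num.sqrt lam.
  apply/eqP; rewrite eq_le (Lambda_sc_ge hd hA I0 eI) andbT -upI.
  exact: Lambda_sc_le.
have sg : sigma = Num.sqrt lam.
  by rewrite /sigma -PhiI hC opnorm_scalar ?lamC // ltW.
by split; rewrite ?upI ?sg.
Qed.
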